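(* Let $\mathcal{H}$ be a complex Hilbert space and let $\alpha,\beta\ge 0$ be real with $(\alpha,\beta)\neq(0,0)$. Then $\|\cdot\|_{\alpha,\beta}$ defines a norm on $\mathcal{B}(\mathcal{H})$, and it is equivalent to the numerical radius norm $w(\cdot)$ and to the usual operator norm $\|\cdot\|$, satisfying for every $T\in\mathcal{B}(\mathcal{H})$ the inequalities $$\sqrt{\alpha+\beta}\;w(T)\le \|T\|_{\alpha,\beta}\le \sqrt{\alpha+4\beta}\;w(T),$$ $$\max\left\{\frac{\sqrt{\alpha+\beta}}{2},\sqrt{\beta}\right\}\|T\|\le \|T\|_{\alpha,\beta}\le \sqrt{\alpha+\beta}\;\|T\|.$$
   Context: $\mathcal{B}(\mathcal{H})$ is the $C^*$-algebra of bounded linear operators on $\mathcal{H}$. For $T\in\mathcal{B}(\mathcal{H})$, $\|T\|$ is the operator norm, $w(T)=\sup\{|\langle Tx,x\rangle|: x\in\mathcal{H},\|x\|=1\}$ is the numerical radius, and $\|T\|_{\alpha,\beta}=\sup\left\{\sqrt{\alpha|\langle Tx,x\rangle|^2+\beta\|Tx\|^2}: x\in\mathcal{H},\|x\|=1\right\}$. *)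

(* Defs.v *)
From HB Require Import structures.
From mathcomp Require Import all_boot all_order all_algebra.
From mathcomp Require Export sesquilinear complex.
From mathcomp Require Import boolp classical_sets functions reals topology normedtype.

Set Implicit Arguments.
Unset Strict Implicit.
Unset Printing Implicit Defensive.

Import Order.TTheory GRing.Theory Num.Theory.

Local Open Scope classical_set_scope.
Local Open Scope ring_scope.

(* MathComp norms over R[i] take values in R[i], on the nonnegative real axis;
   [rnorm] is the same norm read as an element of R. *)
Definition rnorm (R : realType) (V : normedZmodType R[i]) (x : V) : R :=
  complex.Re `|x|.

Lemma rnormD (R : realType) (V : normedZmodType R[i]) (x y : V) :
  rnorm (x + y) <= rnorm x + rnorm y.
Proof.
by have := ler_normD x y; rewrite /rnorm; move: `|x| `|y| `|x + y|;
  move=> [a a'] [b b'] [c c']; rewrite lecE /= => /andP[].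
Qed.

Lemma rnormZ (R : realType) (V : normedModType R[i]) (a : R[i]) (x : V) :
  rnorm (a *: x) = rnorm a * rnorm x.
Proof.
by rewrite /rnorm normrZ normc_def; case: `|x| => u v /=; rewrite mul0r subr0.
Qed.

Lemma rnorm_ge0 (R : realType) (V : normedZmodType R[i]) (x : V) :
  0 <= rnorm x.
Proof. by have := normr_ge0 x; rewrite lecE /= => /andP[]. Qed.

Section BoundedOperators.
Variables (R : realType) (H : normedModType R[i]).

Definition bounded_operators : {pred H -> H} :=
  mem [set f | linear f /\ exists M : R, forall x, rnorm (f x) <= M * rnorm x].

(* B(H), with its pointwise complex vector space structure. *)
Record bounded_operator := BoundedOperator {
  bounded_operator_fun :> H -> H;
  _ : bounded_operator_fun \in bounded_operators }.

HB.instance Definition _ := [isSub for bounded_operator_fun].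
HB.instance Definition _ := [Choice of bounded_operator by <:].

Lemma bounded_operatorsP (f : H -> H) :
  f \in bounded_operators <->
  linear f /\ exists M : R, forall x, rnorm (f x) <= M * rnorm x.
Proof. by split=> [/set_mem|fB]; [|exact: mem_set]. Qed.

Lemma bounded_operators_submod : submod_closed bounded_operators.
Proof.
split=> [|a f g /bounded_operatorsP[lf [M Mf]] /bounded_operatorsP[lg [N Ng]]].
  apply/bounded_operatorsP; split=> [b x y|].
    by rewrite /= scaler0 addr0.
  by exists 0 => x; rewrite mul0r /rnorm normr0.
apply/bounded_operatorsP; split=> [b x y|].
  rewrite !fctE lf lg !scalerDr !scalerA (mulrC a b) -!addrA.
  by congr (_ + _); rewrite addrCA.
exists (rnorm a * M + N) => x; rewrite mulrDl -mulrA (le_trans (rnormD _ _))//.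
by rewrite lerD// rnormZ ler_wpM2l// rnorm_ge0.
Qed.

HB.instance Definition _ :=
  GRing.isSubmodClosed.Build _ _ bounded_operators bounded_operators_submod.
HB.instance Definition _ := [SubChoice_isSubLmodule of bounded_operator by <:].

Lemma bounded_operator_linear (T : bounded_operator) : linear T.
Proof. by have /bounded_operatorsP[] := valP T. Qed.

HB.instance Definition _ (T : bounded_operator) :=
  GRing.isLinear.Build R[i] H H *:%R T (bounded_operator_linear T).

End BoundedOperators.

Section Norms.
Variables (R : realType) (V : lmodType R[i]).

Definition is_norm (N : V -> R) : Prop :=
  [/\ forall x, 0 <= N x,
      forall x, N x = 0 <-> x = 0,
      forall (a : R[i]) x, N (a *: x) = rnorm a * N x
    & forall x y, N (x + y) <= N x + N y].

Definition equivalent_norms (N1 N2 : V -> R) : Prop :=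
  exists c C : R, [/\ 0 < c, 0 < C & forall x, c * N2 x <= N1 x <= C * N2 x].

End Norms.

(* The suprema below are real-valued: [sup] of the empty set is 0, so all three
   quantities are 0 when H is the zero space. *)
Section OperatorNorms.
Variables (R : realType) (H : normedModType R[i]).

Definition operator_norm (T : bounded_operator H) : R :=
  sup [set rnorm (T x) | x in [set x | rnorm x = 1]].

Variable ip : {dot H for Num.conj}.

Definition numerical_radius (T : bounded_operator H) : R :=
  sup [set rnorm (ip (T x) x) | x in [set x | rnorm x = 1]].

Definition alpha_beta_norm (alpha beta : R) (T : bounded_operator H) : R :=
  sup [set Num.sqrt (alpha * rnorm (ip (T x) x) ^+ 2 + beta * rnorm (T x) ^+ 2)
      | x in [set x | rnorm x = 1]].

End OperatorNorms.

(* Main.v *)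
(** On the unit sphere |<Tx,x>| <= ||Tx||, which compares the integrand of
    [alpha_beta_norm] pointwise with those of [numerical_radius] and
    [operator_norm]; the triangle inequality is Minkowski's inequality for the
    weighted Euclidean norm (p, q) |-> sqrt (alpha p^2 + beta q^2).  The bound
    ||T|| <= 2 w(T) comes from polarization: the parallelogram law gives
    |<Tx,y> + <Ty,x>| <= w(T) (||x||^2 + ||y||^2), and replacing y by iy yields
    the same bound for the difference, hence for <Tx,y> alone; take
    y = Tx / ||Tx||. *)
Require Import Defs.
From mathcomp Require Import all_boot all_order all_algebra.
From mathcomp Require Import boolp classical_sets reals topology normedtype.
From mathcomp Require Import ring lra.

Import Order.TTheory GRing.Theory Num.Theory.
Local Open Scope classical_set_scope.
Local Open Scope ring_scope.

(** * Suprema of real functions over a set *)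

Section SupImage.
Context {R : realType} {T : Type}.
Implicit Types (A : set T) (f g : T -> R) (c M : R).

(** The condition [0 <= M] handles an empty [A], where [sup] is 0; the unit sphere of the zero space
    is such a set. *)
Lemma sup_image_le A f M :
  0 <= M -> (forall x, A x -> f x <= M) -> sup (f @` A) <= M.
Proof.
move=> M0 fM; have [->|/set0P fA0] := eqVneq (f @` A) set0; first by rewrite sup0.
by apply: ge_sup => // _ [x Ax <-]; exact: fM.
Qed.

Lemma le_sup_image A f M x :
  (forall y, A y -> f y <= M) -> A x -> f x <= sup (f @` A).
Proof.
move=> fM Ax; apply: ub_le_sup; last by exists x.
by exists M => _ [y Ay <-]; exact: fM.
Qed.

Lemma sup_image_ge0 A f : (forall x, A x -> 0 <= f x) -> 0 <= sup (f @` A).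
Proof.
(* An empty or unbounded image has the default supremum 0. *)
move=> f0; have [fAsup|/sup_out->//] := pselect (has_sup (f @` A)).
have [[y [x Ax _]] _] := fAsup.
by apply: le_trans (f0 x Ax) _; apply: sup_upper_bound => //; exists x.
Qed.

(** For [c > 0] one divides by [c] and bounds each value of [f]; the upper bound [M] ensures that
    [sup] of [g] dominates the values of [g]. *)
Lemma ler_sup_imageM A c f g M : 0 <= c ->
  (forall x, A x -> 0 <= g x <= M) ->
  (forall x, A x -> c * f x <= g x) -> c * sup (f @` A) <= sup (g @` A).
Proof.
rewrite le_eqVlt => /orP[/eqP<-|c0] gM fg.
  by rewrite mul0r; apply: sup_image_ge0 => x /gM/andP[].
have gsup x : A x -> g x <= sup (g @` A).
  by apply: le_sup_image => y /gM/andP[_]; exact.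
rewrite -ler_pdivlMl//; apply: sup_image_le => [|x Ax].
  rewrite mulr_ge0 ?invr_ge0 ?(ltW c0)//.
  by apply: sup_image_ge0 => x /gM/andP[].
by rewrite ler_pdivlMl// (le_trans (fg _ Ax))// gsup.
Qed.

End SupImage.

(** * The weighted Euclidean norm on pairs of reals *)

Section WeightedEuclideanNorm.
Context {R : realType} (alpha beta : R).
Hypotheses (alpha_ge0 : 0 <= alpha) (beta_ge0 : 0 <= beta).

Definition wnorm (p q : R) : R := Num.sqrt (alpha * p ^+ 2 + beta * q ^+ 2).

Lemma wsqr_ge0 p q : 0 <= alpha * p ^+ 2 + beta * q ^+ 2.
Proof. by rewrite addr_ge0// mulr_ge0// sqr_ge0. Qed.

Lemma wnorm_le p q p' q' :
  0 <= p <= p' -> 0 <= q <= q' -> wnorm p q <= wnorm p' q'.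
Proof.
move=> /andP[p0 pp'] /andP[q0 qq']; apply: ler_wsqrtr.
by rewrite lerD// ler_wpM2l// lerXn2r// ?nnegrE//
  (le_trans _ pp', le_trans _ qq').
Qed.

Lemma wnormM c p q : 0 <= c -> wnorm (c * p) (c * q) = c * wnorm p q.
Proof.
move=> c0; rewrite /wnorm -{3}(ger0_norm c0) -sqrtr_sqr -sqrtrM ?sqr_ge0//.
by congr Num.sqrt; ring.
Qed.

Lemma wnormD p q p' q' :
  wnorm (p + p') (q + q') <= wnorm p q + wnorm p' q'.
Proof.
set a := wnorm p q; set b := wnorm p' q'.
have a0 : 0 <= a := sqrtr_ge0 _; have b0 : 0 <= b := sqrtr_ge0 _.
have aE : a ^+ 2 = alpha * p ^+ 2 + beta * q ^+ 2 by rewrite sqr_sqrtr ?wsqr_ge0.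
have bE : b ^+ 2 = alpha * p' ^+ 2 + beta * q' ^+ 2
  by rewrite sqr_sqrtr ?wsqr_ge0.
rewrite -[leRHS]ger0_norm ?addr_ge0// -sqrtr_sqr; apply: ler_wsqrtr.
(* After squaring, Minkowski's inequality reduces to Cauchy-Schwarz for the weighted form. *)
suff : alpha * p * p' + beta * q * q' <= a * b.
  by rewrite (sqrrD a) aE bE => ?; lra.
have ab0 : 0 <= a * b by exact: mulr_ge0.
apply: le_trans (ler_norm _) _; rewrite -(ger0_norm ab0).
rewrite -ler_sqr ?nnegrE ?normr_ge0// !real_normK ?num_real// exprMn aE bE.
rewrite -subr_ge0.
(* Lagrange's identity: the defect in Cauchy-Schwarz is a nonnegative multiple of a square. *)
have -> : (alpha * p ^+ 2 + beta * q ^+ 2) * (alpha * p' ^+ 2 + beta * q' ^+ 2)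
   - (alpha * p * p' + beta * q * q') ^+ 2 = alpha * beta * (p * q' - p' * q) ^+ 2.
  by ring.
by rewrite mulr_ge0 ?sqr_ge0// mulr_ge0.
Qed.

End WeightedEuclideanNorm.

(** * Real-valued reading of complex-valued norms *)

Section RNorm.
Context {R : realType}.

Lemma normr_rnorm (V : normedZmodType R[i]) (x : V) : `|x| = (rnorm x)%:C%C.
Proof.
rewrite /rnorm; have := normr_ge0 x; case: `|x| => u v.
by rewrite lecE /= => /andP[/eqP-> _].
Qed.

Lemma rnorm0_eq0 (V : normedZmodType R[i]) (x : V) : rnorm x = 0 -> x = 0.
Proof. by move=> x0; apply/eqP; rewrite -normr_eq0 normr_rnorm x0. Qed.

Lemma rnorm0 (V : normedZmodType R[i]) : rnorm (0 : V) = 0.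
Proof. by rewrite /rnorm normr0. Qed.

Lemma rnormN (V : normedZmodType R[i]) (x : V) : rnorm (- x) = rnorm x.
Proof. by rewrite /rnorm normrN. Qed.

Lemma rnormM (a b : R[i]) : rnorm (a * b) = rnorm a * rnorm b.
Proof. by rewrite /rnorm normrM !normr_rnorm -rmorphM. Qed.

Lemma rnorm_conj (a : R[i]) : rnorm (Num.conj a) = rnorm a.
Proof. by rewrite /rnorm norm_conjC. Qed.

Lemma rnorm_real (r : R) : 0 <= r -> rnorm r%:C%C = r.
Proof. by move=> r0; rewrite /rnorm ger0_norm// lecR. Qed.

Lemma rnormalize {V : normedModType R[i]} (x : V) : x <> 0 ->
  rnorm (((rnorm x)^-1)%:C%C *: x) = 1.
Proof.
move=> x0; rewrite rnormZ rnorm_real ?invr_ge0 ?rnorm_ge0// mulVf//.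
by apply/eqP => /rnorm0_eq0.
Qed.

End RNorm.

(** * Cauchy-Schwarz, polarization and the bound of the operator norm by the numerical radius *)

Section InnerProduct.
Context {R : realType} {H : normedModType R[i]} (ip : {dot H for Num.conj}).
Hypothesis ip_norm : forall x : H, `|x| ^+ 2 = ip x x.

Lemma ip_rnorm x : ip x x = (rnorm x ^+ 2)%:C%C.
Proof. by rewrite -ip_norm normr_rnorm rmorphXn. Qed.

Lemma rnorm_ip x : rnorm (ip x x) = rnorm x ^+ 2.
Proof. by rewrite ip_rnorm rnorm_real// sqr_ge0. Qed.

Lemma rnorm_parallelogram (x y : H) :
  rnorm (x + y) ^+ 2 + rnorm (x - y) ^+ 2 = 2 * (rnorm x ^+ 2 + rnorm y ^+ 2).
Proof.
apply: (@complexI R); rewrite rmorphM rmorph_nat !rmorphD/= -!ip_rnorm.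
rewrite linearDl linearBl !linearDr/= !linearNr/=.
ring.
Qed.

(** Removing from [z] its projection [a *: x] leaves a vector of squared norm [|z|^2 - |a|^2], which
    is nonnegative. *)
Lemma ip_unit_le (z x : H) : rnorm x = 1 -> rnorm (ip z x) <= rnorm z.
Proof.
move=> x1; set a := ip z x.
have : 0 <= ip (z - a *: x) (z - a *: x) by rewrite -ip_norm exprn_ge0.
have -> : ip (z - a *: x) (z - a *: x) = ip z z - `|a| ^+ 2.
  rewrite linearBl/= !linearBr/= !linearZl_LR !linearZr_LR/= -/a (ip_rnorm x) x1.
  by rewrite expr1n normCK (hermC ip x z)/= expr0 mul1r mulr1 -/a; ring.
rewrite subr_ge0 -ip_norm !normr_rnorm -!rmorphXn lecR.
by rewrite ler_sqr// nnegrE rnorm_ge0.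
Qed.


Context (T : bounded_operator H).

Lemma operator_norm_ub x : rnorm x = 1 -> rnorm (T x) <= operator_norm T.
Proof.
move=> x1; have [_ [M TM]] := (bounded_operatorsP _).1 (valP T).
apply: (@le_sup_image _ _ [set x | rnorm x = 1] (fun x => rnorm (T x)) M) => //.
by move=> y /= y1; have := TM y; rewrite y1 mulr1.
Qed.

Lemma operator_norm_ge0 : 0 <= operator_norm T.
Proof. by apply: sup_image_ge0 => x _; exact: rnorm_ge0. Qed.

Lemma operator_norm_le x : rnorm (T x) <= operator_norm T * rnorm x.
Proof.
have [->|/eqP x0] := eqVneq x 0; first by rewrite linear0 !rnorm0 mulr0.
have x_gt0 : 0 < rnorm x.
  by rewrite lt_neqAle rnorm_ge0 eq_sym andbT; apply/eqP => /rnorm0_eq0.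
have := operator_norm_ub _ (rnormalize _ x0).
by rewrite linearZ/= rnormZ rnorm_real ?invr_ge0 ?rnorm_ge0// ler_pdivrMl// mulrC.
Qed.

Lemma numerical_radius_ub x :
  rnorm x = 1 -> rnorm (ip (T x) x) <= numerical_radius ip T.
Proof.
apply: (@le_sup_image _ _ [set x | rnorm x = 1]
  (fun x => rnorm (ip (T x) x)) (operator_norm T)) => y y1.
exact: le_trans (ip_unit_le _ _ y1) (operator_norm_ub _ y1).
Qed.

Lemma numerical_radius_ge0 : 0 <= numerical_radius ip T.
Proof. by apply: sup_image_ge0 => x _; exact: rnorm_ge0. Qed.

(** Both sides scale quadratically in [x], so the bound on the unit sphere extends to all vectors;
    polarization uses it at [x + y] and [x - y]. *)
Lemma numerical_radius_le x :
  rnorm (ip (T x) x) <= numerical_radius ip T * rnorm x ^+ 2.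
Proof.
have [->|/eqP x0] := eqVneq x 0.
  by rewrite linear0r !rnorm0 expr0n mulr0.
have x_gt0 : 0 < rnorm x.
  by rewrite lt_neqAle rnorm_ge0 eq_sym andbT; apply/eqP => /rnorm0_eq0.
have := numerical_radius_ub _ (rnormalize _ x0).
rewrite [T (_ *: _)]linearZ/= linearZl_LR linearZr_LR/= !rnormM rnorm_conj.
rewrite rnorm_real ?invr_ge0 ?rnorm_ge0// mulrA -expr2 exprVn.
by rewrite mulrC ler_pdivrMr ?exprn_gt0.
Qed.

Lemma rnorm_ip_sym_le x y : rnorm (ip (T x) y + ip (T y) x) <=
  numerical_radius ip T * (rnorm x ^+ 2 + rnorm y ^+ 2).
Proof.
(* The diagonal terms [ip (T x) x] and [ip (T y) y] cancel in the difference, and the cross terms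
   double. *)
have E : (ip (T x) y + ip (T y) x) *+ 2 =
    ip (T (x + y)) (x + y) + - ip (T (x - y)) (x - y).
  rewrite [T (x + y)]linearD [T (x - y)]linearB/= linearDl linearBl/=.
  by rewrite !linearDr/= !linearNr/=; ring.
rewrite -(@ler_pM2l _ 2)// mulrCA -rnorm_parallelogram mulrDr.
have -> : 2 * rnorm (ip (T x) y + ip (T y) x) =
    rnorm ((ip (T x) y + ip (T y) x) *+ 2).
  by rewrite /rnorm normrMn normr_rnorm -rmorphMn/= mulr_natl.
by rewrite E (le_trans (rnormD _ _))// rnormN lerD// numerical_radius_le.
Qed.

Lemma rnorm_ip_le x y : rnorm (ip (T x) y) <=
  numerical_radius ip T * (rnorm x ^+ 2 + rnorm y ^+ 2).
Proof.
have xy := rnorm_ip_sym_le x y.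
have i1 : rnorm ('i%C : R[i]) = 1.
  by rewrite /rnorm normc_def /= expr0n expr1n add0r sqrtr1.
have := rnorm_ip_sym_le x ('i%C *: y).
rewrite rnormZ i1 mul1r.
(* The form is conjugate-linear in its second argument, so ['i] leaves as [- 'i] from one term and
   as ['i] from the other, turning the sum into a difference. *)
have -> : ip (T x) ('i%C *: y) + ip (T ('i%C *: y)) x =
    - 'i%C * (ip (T x) y - ip (T y) x).
  rewrite [T (_ *: _)]linearZ/= linearZl_LR linearZr_LR/=.
  have -> : Num.conj ('i%C : R[i]) = - 'i%C.
    by apply/eqP; rewrite eq_complex/= oppr0 !eqxx.
  ring.
rewrite rnormM rnormN i1 mul1r => xiy.
have := lerD xy xiy; rewrite -mulr2n -(mulr_natl _ 2).
set w := numerical_radius ip T * _ => le2w.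
rewrite -(@ler_pM2l _ 2)// (le_trans _ le2w)// (le_trans _ (rnormD _ _))//.
have -> : ip (T x) y + ip (T y) x + (ip (T x) y - ip (T y) x) = ip (T x) y *+ 2.
  by ring.
by rewrite /rnorm normrMn normr_rnorm -rmorphMn/= mulr_natl.
Qed.

Lemma rnorm_le_numerical_radius x :
  rnorm x = 1 -> rnorm (T x) <= 2 * numerical_radius ip T.
Proof.
move=> x1; have [Tx0|/eqP Tx0] := eqVneq (T x) 0.
  by rewrite Tx0 rnorm0 mulr_ge0// numerical_radius_ge0.
(* Both vectors are unit, so the right-hand side is twice the numerical radius, while the inner
   product has modulus [rnorm (T x)]. *)
have := rnorm_ip_le x (((rnorm (T x))^-1)%:C%C *: T x).
rewrite x1 rnormalize// linearZr_LR/= rnormM rnorm_conj rnorm_ip.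
rewrite rnorm_real ?invr_ge0 ?rnorm_ge0// expr1n expr2 mulrA mulVf ?mul1r.
  by rewrite mulrC.
by apply/eqP => /rnorm0_eq0.
Qed.

End InnerProduct.

(** * Comparison inequalities and norm properties of [alpha_beta_norm] *)

Section AlphaBeta.
Context {R : realType} {H : normedModType R[i]} (ip : {dot H for Num.conj}).
Hypothesis ip_norm : forall x : H, `|x| ^+ 2 = ip x x.
Context (alpha beta : R).
Hypotheses (alpha_ge0 : 0 <= alpha) (beta_ge0 : 0 <= beta).
Implicit Type T : bounded_operator H.
Local Notation wn := (wnorm alpha beta).
Local Notation sphere := [set x : H | rnorm x = 1].

(** Both coordinates are at most the operator norm. This uniform bound makes the supremum defining
    [alpha_beta_norm] finite, as every later comparison from below requires. *)
Lemma wnorm_op_le T x : rnorm x = 1 ->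
  0 <= wn (rnorm (ip (T x) x)) (rnorm (T x))
    <= Num.sqrt (alpha + beta) * operator_norm T.
Proof.
move=> x1; rewrite sqrtr_ge0 /=.
have T0 := operator_norm_ge0 T.
apply: (@le_trans _ _ (wn (operator_norm T) (operator_norm T))).
  have Tx := operator_norm_ub T _ x1.
  apply: wnorm_le; rewrite ?rnorm_ge0//=.
  by rewrite (le_trans (ip_unit_le _ ip_norm _ _ x1)).
by rewrite /wnorm -mulrDl sqrtrM ?addr_ge0// sqrtr_sqr ger0_norm.
Qed.

Lemma le_alpha_beta_norm T x : rnorm x = 1 ->
  wn (rnorm (ip (T x) x)) (rnorm (T x)) <= alpha_beta_norm ip alpha beta T.
Proof.
apply: (@le_sup_image _ _ sphere
  (fun x => wn (rnorm (ip (T x) x)) (rnorm (T x)))) => y y1.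
by have /andP[_] := wnorm_op_le T _ y1; exact.
Qed.

Lemma alpha_beta_norm_le T M : 0 <= M ->
  (forall x, rnorm x = 1 -> wn (rnorm (ip (T x) x)) (rnorm (T x)) <= M) ->
  alpha_beta_norm ip alpha beta T <= M.
Proof. exact: sup_image_le. Qed.

Lemma alpha_beta_norm_ge0 T : 0 <= alpha_beta_norm ip alpha beta T.
Proof. by apply: sup_image_ge0 => x _; exact: sqrtr_ge0. Qed.

Lemma alpha_beta_norm_le_operator_norm T :
  alpha_beta_norm ip alpha beta T <= Num.sqrt (alpha + beta) * operator_norm T.
Proof.
apply: alpha_beta_norm_le => [|x x1].
  by rewrite mulr_ge0 ?sqrtr_ge0 ?operator_norm_ge0.
by have /andP[] := wnorm_op_le T _ x1.
Qed.

Lemma alpha_beta_norm_le_numerical_radius T :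
  alpha_beta_norm ip alpha beta T
    <= Num.sqrt (alpha + 4 * beta) * numerical_radius ip T.
Proof.
have w0 := numerical_radius_ge0 ip T.
apply: alpha_beta_norm_le => [|x x1]; first by rewrite mulr_ge0 ?sqrtr_ge0.
(* The constant 4 in the result is the square of the factor 2 bounding [rnorm (T x)]. *)
apply: (@le_trans _ _ (wn (numerical_radius ip T) (2 * numerical_radius ip T))).
  apply: wnorm_le; rewrite ?rnorm_ge0//= ?numerical_radius_ub//.
  exact: rnorm_le_numerical_radius.
rewrite -{3}(ger0_norm w0) -sqrtr_sqr -sqrtrM ?addr_ge0 ?mulr_ge0//.
rewrite [leLHS](_ : _ = Num.sqrt ((alpha + 4 * beta) * numerical_radius ip T ^+ 2))//.
by rewrite /wnorm; congr Num.sqrt; ring.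
Qed.

Lemma numerical_radius_le_alpha_beta_norm T :
  Num.sqrt (alpha + beta) * numerical_radius ip T
    <= alpha_beta_norm ip alpha beta T.
Proof.
apply: (ler_sup_imageM sphere) (sqrtr_ge0 _) (wnorm_op_le T) _ => x x1.
(* Lowering the second coordinate to the first, by Cauchy-Schwarz, yields the factor
   [sqrt (alpha + beta)]. *)
have -> : Num.sqrt (alpha + beta) * rnorm (ip (T x) x) =
    wn (rnorm (ip (T x) x)) (rnorm (ip (T x) x)).
  by rewrite /wnorm -mulrDl sqrtrM ?addr_ge0// sqrtr_sqr ger0_norm ?rnorm_ge0.
by apply: wnorm_le; rewrite ?rnorm_ge0 ?lexx//= ip_unit_le.
Qed.

Lemma operator_norm_le_numerical_radius T :
  operator_norm T <= 2 * numerical_radius ip T.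
Proof.
apply: sup_image_le => [|x x1]; last exact: rnorm_le_numerical_radius.
by rewrite mulr_ge0// numerical_radius_ge0.
Qed.

Lemma operator_norm_le_alpha_beta_norm T :
  Num.max (Num.sqrt (alpha + beta) / 2) (Num.sqrt beta) * operator_norm T
    <= alpha_beta_norm ip alpha beta T.
Proof.
rewrite maxr_pMl ?operator_norm_ge0// ge_max; apply/andP; split.
  (* The first constant passes through the numerical radius, which is at least half the operator
     norm. *)
  apply: le_trans (numerical_radius_le_alpha_beta_norm T).
  rewrite -mulrA ler_wpM2l ?sqrtr_ge0// ler_pdivrMl//.
  exact: operator_norm_le_numerical_radius.
apply: (ler_sup_imageM sphere) (sqrtr_ge0 _) (wnorm_op_le T) _ => x x1.
(* The second constant comes from lowering the first coordinate to 0. *)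
have -> : Num.sqrt beta * rnorm (T x) = wn 0 (rnorm (T x)).
  rewrite /wnorm expr0n mulr0 add0r sqrtrM// sqrtr_sqr.
  by rewrite ger0_norm ?rnorm_ge0.
by apply: wnorm_le; rewrite ?lexx ?rnorm_ge0.
Qed.

(** The integrand is itself homogeneous; comparing suprema in both directions also covers
    [a = 0]. *)
Lemma alpha_beta_normZ (a : R[i]) T :
  alpha_beta_norm ip alpha beta (a *: T) =
    rnorm a * alpha_beta_norm ip alpha beta T.
Proof.
have aT x : wn (rnorm (ip ((a *: T) x) x)) (rnorm ((a *: T) x)) =
    rnorm a * wn (rnorm (ip (T x) x)) (rnorm (T x)).
  have -> : (a *: T) x = a *: T x by [].
  by rewrite linearZl_LR/= rnormM rnormZ wnormM ?rnorm_ge0.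
apply/eqP; rewrite eq_le; apply/andP; split.
  apply: alpha_beta_norm_le => [|x x1].
    by rewrite mulr_ge0 ?rnorm_ge0 ?alpha_beta_norm_ge0.
  by rewrite aT ler_wpM2l ?rnorm_ge0// le_alpha_beta_norm.
apply: (ler_sup_imageM sphere) (rnorm_ge0 _) (wnorm_op_le (a *: T)) _ => x x1.
by rewrite aT.
Qed.

Lemma alpha_beta_normD S T : alpha_beta_norm ip alpha beta (S + T)
  <= alpha_beta_norm ip alpha beta S + alpha_beta_norm ip alpha beta T.
Proof.
apply: alpha_beta_norm_le => [|x x1]; first by rewrite addr_ge0 ?alpha_beta_norm_ge0.
have -> : (S + T) x = S x + T x by [].
rewrite linearDl/= (le_trans _ (lerD (le_alpha_beta_norm _ _ x1)
  (le_alpha_beta_norm _ _ x1)))// (le_trans _ (wnormD _ _ _ _ _ _ _ _))//.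
by apply: wnorm_le => //; rewrite rnorm_ge0 rnormD.
Qed.

Lemma operator_norm0_eq0 T : operator_norm T = 0 -> T = 0.
Proof.
move=> T0; apply/val_inj/funext => x; apply/rnorm0_eq0/eqP.
by rewrite eq_le rnorm_ge0 andbT (le_trans (operator_norm_le T x))// T0 mul0r.
Qed.

End AlphaBeta.

(** * Norm axioms and equivalence of the three norms *)

Theorem theorem2p1 (R : realType) (H : completeNormedModType R[i])
    (ip : {dot H for Num.conj}) (ip_norm : forall x : H, `|x| ^+ 2 = ip x x)
    (alpha beta : R) (alpha_ge0 : 0 <= alpha) (beta_ge0 : 0 <= beta)
    (alpha_beta_neq0 : (alpha, beta) <> (0, 0)) :
  [/\ is_norm (alpha_beta_norm ip alpha beta),
      equivalent_norms (alpha_beta_norm ip alpha beta) (numerical_radius ip),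
      equivalent_norms (alpha_beta_norm ip alpha beta) (@operator_norm R H),
      forall T : bounded_operator H,
        Num.sqrt (alpha + beta) * numerical_radius ip T
          <= alpha_beta_norm ip alpha beta T
          <= Num.sqrt (alpha + 4 * beta) * numerical_radius ip T
    & forall T : bounded_operator H,
        Num.max (Num.sqrt (alpha + beta) / 2) (Num.sqrt beta) * operator_norm T
          <= alpha_beta_norm ip alpha beta T
          <= Num.sqrt (alpha + beta) * operator_norm T].
Proof.
(* Two nonnegative reals that are not both zero have a positive sum; positivity of all the
   equivalence constants follows from this. *)
have ab_gt0 : 0 < alpha + beta.
  rewrite lt_neqAle addr_ge0// andbT eq_sym paddr_eq0//.
  by apply/negP => /andP[/eqP a0 /eqP b0]; rewrite a0 b0 in alpha_beta_neq0.
have w_bounds T := conj (numerical_radius_le_alpha_beta_norm ip ip_norm _ _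
    alpha_ge0 beta_ge0 T)
  (alpha_beta_norm_le_numerical_radius ip ip_norm _ _ alpha_ge0 beta_ge0 T).
have n_bounds T := conj (operator_norm_le_alpha_beta_norm ip ip_norm _ _
    alpha_ge0 beta_ge0 T)
  (alpha_beta_norm_le_operator_norm ip ip_norm _ _ alpha_ge0 beta_ge0 T).
have sqrt_gt0 : 0 < Num.sqrt (alpha + beta) by rewrite sqrtr_gt0.
have max_gt0 : 0 < Num.max (Num.sqrt (alpha + beta) / 2) (Num.sqrt beta).
  by rewrite lt_max divr_gt0.
split.
- split => [T|T|a T|S T]; first exact: alpha_beta_norm_ge0.
  + split=> [N0|->].
      (* Definiteness is inherited from the operator norm through the lower bound with positive
         constant. *)
      apply/operator_norm0_eq0/eqP; rewrite eq_le operator_norm_ge0 andbT.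
      have [+ _] := n_bounds T.
      by rewrite N0 pmulr_rle0.
    (* The value at 0 follows from homogeneity with scalar 0. *)
    by rewrite -(scale0r 0) alpha_beta_normZ// rnorm0 mul0r.
  + exact: alpha_beta_normZ.
  + exact: alpha_beta_normD.
- exists (Num.sqrt (alpha + beta)), (Num.sqrt (alpha + 4 * beta)).
  split=> // [|T]; last exact/andP/w_bounds.
  by rewrite sqrtr_gt0 (lt_le_trans ab_gt0)// lerD2l ler_peMl// ler1n.
- exists (Num.max (Num.sqrt (alpha + beta) / 2) (Num.sqrt beta)).
  by exists (Num.sqrt (alpha + beta)); split=> // T; exact/andP/n_bounds.
- by move=> T; exact/andP/w_bounds.
- by move=> T; exact/andP/n_bounds.
Qed.
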